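(* Let $G$ be a profinite group which has alternating composition factors of unbounded degree, i.e. for every $N$ there is $k\ge N$ such that the alternating group $A_k$ is a composition factor of some finite continuous quotient of $G$. Then for every $n\ge1$, almost every $n$-tuple of elements of $G$ (with respect to the product of the normalized Haar measure) generates a free subgroup.
   Context: A profinite group carries a unique invariant probability (Haar) measure; ''almost every'' means outside a set of measure zero in $G^n$. The composition factors of a profinite group $G$ are the composition factors of its finite quotients $G/N$ with $N$ open normal. *)

(* Defs.v *)
From HB Require Import structures.
From mathcomp Require Import all_boot all_order all_algebra all_fingroup all_solvable.
From mathcomp Require Import all_classical all_reals all_analysis.

Set Implicit Arguments.
Unset Strict Implicit.
Unset Printing Implicit Defensive.

Local Open Scope classical_set_scope.

Definition is_profinite_group (G : ptopologicalType)
  (mul : G -> G -> G) (inv : G -> G) (one : G) : Prop :=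
  [/\ (forall x y z, mul x (mul y z) = mul (mul x y) z),
      (forall x, mul one x = x) /\ (forall x, mul (inv x) x = one),
      continuous (fun p : G * G => mul p.1 p.2) /\ continuous inv,
      compact [set: G] /\ hausdorff_space G
      & totally_disconnected [set: G]].

(* A finite continuous quotient of G: a continuous (for the discrete topology
   on Q, i.e. all fibres open) surjective group homomorphism onto a finite
   group Q. *)
Definition continuous_finite_quotient (G : ptopologicalType)
  (mul : G -> G -> G) (Q : finGroupType) (f : G -> Q) : Prop :=
  [/\ (forall x y, f (mul x y) = (f x * f y)%g),
      (forall q : Q, exists x, f x = q)
    & (forall q : Q, open (f @^-1` [set q]))].

Definition alt_composition_factor (Q : finGroupType) (k : nat) : Prop :=
  exists s : seq {group Q},
    comps [set: Q]%G s /\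
    exists2 i, (i < size s)%N &
      ((nth [set: Q]%G ([set: Q]%G :: s) i)
         / (nth [set: Q]%G ([set: Q]%G :: s) i.+1))%g \isog (Alt 'I_k).

Definition unbounded_alt_factors (G : ptopologicalType)
  (mul : G -> G -> G) : Prop :=
  forall N : nat, exists2 k : nat, (N <= k)%N &
    exists (Q : finGroupType) (f : G -> Q),
      continuous_finite_quotient mul f /\ alt_composition_factor Q k.

(* Words in the free group on n generators: letters (i, b) stand for x_i if
   b = false and x_i^{-1} if b = true. *)
Definition word (n : nat) := seq ('I_n * bool).

Fixpoint reduced_word (n : nat) (w : word n) : bool :=
  match w with
  | a :: ((b :: _) as t) => ~~ ((a.1 == b.1) && (a.2 != b.2)) && reduced_word t
  | _ => true
  end.

Definition eval_word (G : Type) (mul : G -> G -> G) (inv : G -> G) (one : G)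
  (n : nat) (w : word n) (x : 'I_n -> G) : G :=
  foldr (fun a acc => mul (if a.2 then inv (x a.1) else x a.1) acc) one w.

Definition freely_generates (G : Type) (mul : G -> G -> G) (inv : G -> G)
  (one : G) (n : nat) (x : 'I_n -> G) : Prop :=
  forall w : word n, reduced_word w -> w <> [::] -> eval_word mul inv one w x <> one.

Definition borel_tuples (G : ptopologicalType) (n : nat) :=
  g_sigma_algebraType (@open {ptws 'I_n -> G}).

Definition ltrans (G : ptopologicalType) (mul : G -> G -> G) (n : nat)
  (g : 'I_n -> G) (x : borel_tuples G n) : borel_tuples G n :=
  fun i => mul (g i) (x i).

Definition haar_probability (G : ptopologicalType) (mul : G -> G -> G)
  (n : nat) (R : realType) (mu : probability (borel_tuples G n) R) : Prop :=
  forall (g : 'I_n -> G) (A : set (borel_tuples G n)),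
    measurable A -> mu (ltrans mul g @^-1` A) = mu A.

(* Main.v *)
(* Fix a reduced word w of length L > 0. If G has A_k as a composition factor, some
   finite quotient Q of G has subgroups S <| N <| Q with S simple and isomorphic
   to A_k. Let Q act by conjugation on the class Omega of a 3-cycle p0 of S. The
   conjugates of S commute pairwise, and a conjugate of p0 moves at most 9 points
   in the conjugate of S containing it, so for V in Omega with at most L elements
   all but D(L) points of Omega have orbits of size at least k - 9L - 10 under the
   centraliser of V. Hence, for random x in Q^n, the walk of p0 along the letters of
   w(x) stays away from the points already visited, and so w(x) <> 1, with
   probability at least 1 - L D(L) / (k - 9L - 10). By invariance, Haar measure maps
   to the counting measure of Q^n; as k is unbounded, w(x) = 1 has measure zero,
   and there are countably many words. *)

Require Import Defs.
From HB Require Import structures.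
From mathcomp Require Import all_boot all_order all_algebra all_fingroup all_solvable.
From mathcomp Require Import zify.
Set Implicit Arguments.
Unset Strict Implicit.
Unset Printing Implicit Defensive.
Import GroupScope.

(** * Random walks along a word *)

Lemma card_fiber (T T' : finType) (f : T -> T') (A : {set T}) :
  #|A| = \sum_q #|[set x in A | f x == q]|.
Proof.
rewrite -sum1_card (partition_big f predT) //; apply: eq_bigr => q _.
by rewrite -sum1dep_card.
Qed.

Section RandomWalk.
Variables (gT : finGroupType) (n : nat).
Implicit Types (l : 'I_n * bool) (x y : {ffun 'I_n -> gT}).
Implicit Types (w : word n) (K : seq (('I_n * bool) * gT * gT)) (V : seq gT).

Definition letter_val x l : gT := if l.2 then (x l.1)^-1 else x l.1.

Definition letter_inv l : 'I_n * bool := (l.1, ~~ l.2).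

Definition word_val w x : gT := eval_word (@mulg gT) (@invg gT) 1 w x.

(** Multiplies on the side that depends on the sign of [l], so that the value of [l] always gains
    the left factor [c^-1]. *)
Definition letter_upd x l (c : gT) : {ffun 'I_n -> gT} :=
  [ffun i => if i == l.1 then (if l.2 then x i * c else c^-1 * x i) else x i].

(* An entry (l, a, b) of K records that the letter l conjugates a to b. *)
Definition tuples_over K : {set {ffun 'I_n -> gT}} :=
  [set x | all (fun c => c.1.2 ^ letter_val x c.1.1 == c.2) K].

Lemma letter_upd_val x l c : letter_val (letter_upd x l c) l = c^-1 * letter_val x l.
Proof.
rewrite /letter_val /letter_upd ffunE eqxx; case: l.2 => //=.
by rewrite invMg.
Qed.

Lemma letter_upd_inv x l c :
  letter_val (letter_upd x l c) (letter_inv l) = letter_val x (letter_inv l) * c.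
Proof.
rewrite /letter_val /letter_upd ffunE /= eqxx; case: l.2 => //=.
by rewrite invMg invgK.
Qed.

Lemma letter_upd_neq x l l' c : l'.1 != l.1 ->
  letter_val (letter_upd x l c) l' = letter_val x l'.
Proof. by move=> /negPf ll'; rewrite /letter_val /letter_upd ffunE ll'. Qed.

Lemma letter_updK x l c : letter_upd (letter_upd x l c) l c^-1 = x.
Proof.
apply/ffunP => i; rewrite !ffunE; case: eqP => // _.
by case: l.2; rewrite ?mulgK // invgK mulKVg.
Qed.

Lemma letterP l l' : [\/ l' = l, l' = letter_inv l | l'.1 != l.1].
Proof.
case: l l' => i b [i' b'] /=; case: (eqVneq i' i) => [->|]; last by constructor 3.
case: (eqVneq b' b) => [->|nb]; [by constructor 1|constructor 2].
by rewrite /letter_inv /=; case: b b' nb => [] [].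
Qed.

(* Once the letter l is only constrained at elements of V, the image of p under
   it is spread evenly over a translate of the orbit of p under 'C(V). *)
Lemma card_tuples_over_cons K V l p q :
    (forall c, c \in K -> c.1.1 = l -> c.1.2 \in V) ->
    (forall c, c \in K -> c.1.1 = letter_inv l -> c.2 \in V) ->
  #|p ^: 'C([set:: V])| * #|tuples_over ((l, p, q) :: K)| <= #|tuples_over K|.
Proof.
move=> KV KV'; set C := 'C(_).
(* A chosen element of [C] carrying [p] to [r]; the default 1 is never reached on the orbit. *)
pose cr r := odflt 1 [pick c in C | r == p ^ c].
have crP r : r \in p ^: C -> cr r \in C /\ p ^ cr r = r.
  case/imsetP => c cC ->; rewrite /cr; case: pickP => /= [c' /andP[? /eqP ->] //|/(_ c)].
  by rewrite cC eqxx.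
have commV c a : c \in C -> a \in V -> a ^ c = a.
  by move=> /centP cC aV; apply/conjg_fixP/commgP/commute_sym/cC; rewrite inE.
pose F (u : gT * {ffun 'I_n -> gT}) := letter_upd u.2 l (cr u.1).
rewrite -cardsX -(@card_in_imset _ _ F).
  apply/subset_leq_card/subsetP => y /imsetP[[r x] /setXP[rC]].
  rewrite inE => /andP[/eqP /= xl /allP xK] ->; have [cC pc] := crP _ rC.
  have cVC : (cr r)^-1 \in C by rewrite groupV.
  (* The update inserts [(cr r)^-1] before the value of [l], where it fixes the sources in [V], and
     [cr r] after that of its inverse, where it fixes the targets in [V]. *)
  rewrite inE; apply/allP => -[[l' a] b] cK /=; have /eqP := xK _ cK; rewrite /F /=.
  case: (letterP l l') => [El|El|ll']; last by rewrite letter_upd_neq // => ->.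
    by rewrite El letter_upd_val conjgM (commV _ _ cVC) ?(KV _ cK) // => ->.
  by rewrite El letter_upd_inv conjgM => ->; rewrite commV ?(KV' _ cK).
move=> [r1 x1] [r2 x2] /setXP[rC1 x1K] /setXP[rC2 x2K] EF.
(* Injectivity of [F]: the new value of [l] sends [r] to [q], so [r] can be read off the updated
   tuple, and then the update can be undone. *)
have rE r x : r \in p ^: C -> x \in tuples_over ((l, p, q) :: K) ->
    r = q ^ (letter_val (F (r, x)) l)^-1.
  move=> rC; rewrite inE => /andP[/eqP /= <- _]; have [_ pc] := crP _ rC.
  by rewrite letter_upd_val -conjgM invMg invgK mulKVg pc.
have Er : r1 = r2 by rewrite (rE _ _ rC1 x1K) (rE _ _ rC2 x2K) EF.
rewrite Er; congr pair; rewrite -(letter_updK x1 l (cr r1)) -(letter_updK x2 l (cr r1)).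
by move: EF; rewrite /F /= -Er => ->.
Qed.

Variables (Omega : {set gT}) (L B D : nat) (p0 : gT).
Hypothesis Omega_inv : forall a (c : gT), a \in Omega -> a ^ c \in Omega.
Hypothesis B_gt1 : 1 < B.

(* The points whose next position is not random enough once V is known. *)
Definition small_orbits V := [set q in Omega | #|q ^: 'C([set:: V])| < B].

Hypothesis card_small_orbits : forall V,
  {subset V <= Omega} -> size V <= L -> #|small_orbits V| <= D.

(** The centraliser of [V] fixes each point of [V], and [B] exceeds 1. Thus a walk that avoids small
    orbits never revisits a point. *)
Lemma mem_small_orbits V q : q \in Omega -> q \in V -> q \in small_orbits V.
Proof.
move=> qO qV; rewrite inE qO /= (_ : q ^: _ = [set q]) ?cards1 //.
apply/eqP; rewrite eqEsubset sub1set class_refl andbT.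
apply/subsetP => _ /imsetP[c /centP cC ->]; rewrite inE; apply/eqP.
by apply/conjg_fixP/commgP/commute_sym/cC; rewrite inE.
Qed.

(* The walk p, p ^ l1, p ^ (l1 l2), ... is revealed one letter at a time: V lists
   the points before p, K the letter values read so far and o the last letter. *)
Lemma card_walk_return w K V p (o : option ('I_n * bool)) :
    size V + size w <= L -> p \in Omega -> {subset V <= Omega} ->
    p \notin small_orbits V -> p0 \in p :: V -> (w = [::] -> p <> p0) ->
    (forall c, c \in K ->
       c.1.2 \in V /\ (c.2 \in V \/ c.2 = p /\ o = Some c.1.1)) ->
    reduced_word (if o is Some l then l :: w else w) ->
  B * #|[set x in tuples_over K | p ^ word_val w x == p0]|
    <= size w * D * #|tuples_over K|.
Proof.
elim: w K V p o => [|l w IHw] K V p o /= szV pO VO pV p0V wp0 KV red.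
  rewrite (_ : [set _ in _ | _] = set0) ?cards0 ?muln0 //.
  by apply/setP => x; rewrite !inE conjg1 (introF eqP (wp0 erefl)) andbF.
have redw : reduced_word (l :: w).
  by case: o {KV} red => [l0|//] /andP[].
have pVO : {subset p :: V <= Omega}.
  by move=> a; rewrite inE => /orP[/eqP ->|/VO].
pose XK q := tuples_over ((l, p, q) :: K).
have XKE q : XK q = [set x in tuples_over K | p ^ letter_val x l == q].
  by apply/setP => x; rewrite !inE /= andbC.
have XKB q : B * #|XK q| <= #|tuples_over K|.
  apply: leq_trans (@card_tuples_over_cons K V l p q _ _).
  - by rewrite leq_mul2r; move: pV; rewrite inE pO /= -leqNgt => ->; rewrite orbT.
  - by move=> c /KV[].
  (* A constraint on the inverse of [l] with target outside [V] would come from the last letter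
     read, against reducedness. *)
  move=> c cK cl; have [_ [//|[_ oE]]] := KV c cK.
  by move: red; rewrite oE cl /= eqxx /=; case: l.2.
rewrite (card_fiber (fun x => p ^ letter_val x l)) big_distrr /=.
(* A next point [q] in [small_orbits (p :: V)] is charged the bound [XKB], and there are at most [D]
   of these. Any other [q] in [Omega] is handled by induction. *)
have step q : B * #|[set x in [set x in tuples_over K | p ^ word_val (l :: w) x == p0]
      | p ^ letter_val x l == q]|
    <= (q \in small_orbits (p :: V)) * #|tuples_over K| + size w * D * #|XK q|.
  rewrite (_ : [set _ in _ | _] = [set x in XK q | q ^ word_val w x == p0]); last first.
    apply/setP => x; rewrite XKE !inE -!andbA; congr (_ && _); rewrite andbC.
    apply: andb_id2l => /eqP <-; rewrite -conjgM //.
  case: (boolP (q \in _)) => [_|qV].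
    rewrite mul1n; apply: leq_trans (leq_addr _ _); apply: leq_trans (XKB q).
    rewrite leq_mul2l; apply/orP; right; apply/subset_leq_card/subsetP => x.
    by rewrite inE => /andP[].
  rewrite mul0n add0n; case: (boolP (q \in Omega)) => [qO|qO]; last first.
    rewrite (_ : [set _ in _ | _] = set0) ?cards0 ?muln0 //.
    apply/setP => x; rewrite XKE !inE; apply/negP => /andP[/andP[_ /eqP Eq] _].
    by move: qO; rewrite -Eq Omega_inv.
  apply: (IHw _ (p :: V) q (Some l)) => //=; first by rewrite addSnnS.
  - by rewrite inE p0V orbT.
  - by move=> _ qp0; move: qV; rewrite mem_small_orbits // qp0.
  move=> c; rewrite inE => /orP[/eqP -> /=|cK].
    by split; [rewrite mem_head|right].
  have [cV cV'] := KV c cK; split; first by rewrite inE cV orbT.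
  by left; rewrite inE; case: cV' => [->|[-> _]]; rewrite ?eqxx ?orbT.
apply: (@leq_trans (\sum_q ((q \in small_orbits (p :: V)) * #|tuples_over K|
    + size w * D * #|XK q|))); first by apply: leq_sum => q _; apply: step.
rewrite big_split /= mulSn mulnDl leq_add //.
  rewrite -big_distrl /= leq_mul2r; apply/orP; right.
  rewrite -big_mkcond /= sum1_card; apply: (card_small_orbits pVO) => /=.
  by apply: leq_trans szV; rewrite addnS ltnS leq_addr.
rewrite -big_distrr /= leq_mul2l; apply/orP; right.
rewrite [leqRHS](card_fiber (fun x => p ^ letter_val x l)).
by apply: leq_sum => q _; rewrite XKE.
Qed.

(** Where [w] takes the value 1, the walk that starts at [p0] with nothing revealed returns to
    [p0]. *)
Lemma card_word_eq1 w : reduced_word w -> w <> [::] -> size w <= L ->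
    p0 \in Omega -> p0 \notin small_orbits [::] ->
  B * #|[set x | word_val w x == 1]| <= size w * D * #|{ffun 'I_n -> gT}|.
Proof.
move=> red w0 szw pO pV.
have -> : #|{ffun 'I_n -> gT}| = #|tuples_over [::]|.
  by rewrite -cardsT; congr #|pred_of_set _|; apply/setP => x; rewrite !inE.
apply: leq_trans (@card_walk_return w [::] [::] p0 None _ _ _ _ _ _ _ _) => //.
  rewrite leq_mul2l; apply/orP; right; apply/subset_leq_card/subsetP => x.
  by rewrite !inE /= => /eqP ->; rewrite conjg1.
exact: mem_head.
Qed.
End RandomWalk.

(** * Small conjugacy classes of the alternating group *)

Section SmallSupport.
Variable T : finType.
Implicit Types (s q : {perm T}) (U : {set T}).

Definition moved s : {set T} := [set a | s a != a].

Lemma perm_on_moved s U : perm_on U s = (moved s \subset U).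
Proof. by apply: eq_subset => a; rewrite !inE. Qed.

(** Greedy choice: a new point must avoid the points of [u], their images and their preimages, so
    each pair excludes at most three moved points. *)
Lemma moved_pairs s r : 3 * r < #|moved s| + 3 ->
  exists u : r.-tuple T, uniq (u ++ map s u).
Proof.
elim: r => [|r IHr] hr; first by exists [tuple].
have [|u uu] := IHr; first lia.
have /card_gt0P[a] : 0 < #|moved s :\: [set x in u ++ map s u ++ map s^-1 u]|.
  rewrite cardsD subn_gt0; apply: (@leq_ltn_trans (3 * r)); last lia.
  apply: (leq_trans (subset_leq_card (subsetIr _ _))).
  by rewrite cardsE (leq_trans (card_size _)) // !size_cat !size_map size_tuple; lia.
rewrite inE => /andP[+ am]; rewrite inE !mem_cat !negb_or => /and3P[au asu asVu].
exists [tuple of a :: u].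
have sau : s a \notin u.
  apply: contra asVu => sau; apply/mapP; exists (s a) => //.
  by rewrite permK.
have saa : s a != a by move: am; rewrite inE.
move: uu; rewrite !cat_uniq /= => /and3P[-> /hasPn uu ->].
rewrite au (mem_map (@perm_inj _ s)) au /= !andbT; apply/negP.
rewrite inE (negPf saa) (negPf sau) /= => /hasP[b bsu].
rewrite inE => /orP[/eqP Eb|bu]; last by have := uu _ bsu; rewrite /= bu.
by rewrite -Eb bsu in asu.
Qed.

Lemma ffact8_gt (k : nat) : 1000 <= k -> (k ^ 7 < k ^_ 8)%N.
Proof.
move=> hk; apply: (@leq_trans ((k - 7) ^ 8)%N).
  have h1 : (k ^ 8 <= 2 ^ 8 * (k - 7) ^ 8)%N.
    by rewrite -expnMn leq_exp2r //; lia.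
  have h2 : (0 < k ^ 7)%N by rewrite expn_gt0; lia.
  by move: h1; rewrite expnS; set X := (k ^ 7)%N in h2 *; set Y := ((_ - _) ^ _)%N; nia.
rewrite !ffactnS ffactn0 muln1 !expnS expn0 muln1.
by do !apply: leq_mul; lia.
Qed.

(** Ten moved points give four disjoint pairs (a, s a). As ['Alt_T] is 8-transitive, every 8-tuple
    of distinct points comes from a conjugate of [s] and a 4-tuple, which leaves at most k^3 k^4 of
    them, too few by [ffact8_gt]. *)
Lemma card_moved_le s : 1000 <= #|T| -> (#|s ^: 'Alt_T| <= #|T| ^ 3)%N -> #|moved s| <= 9.
Proof.
move=> hT hs; rewrite leqNgt; apply/negP => hm.
have [|u uu] := @moved_pairs s 4; first lia.
pose t0 : (4 + 4).-tuple T := cat_tuple u (map_tuple s u).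
have t0d : t0 \in (4 + 4).-dtuple([set: T]).
  by rewrite inE uu /=; apply/subsetP => x; rewrite inE.
have trA : [transitive^(4 + 4)%N 'Alt_T, on [set: T] | 'P].
  by apply: ntransitive_weak (Alt_trans T); lia.
(* t is recovered from its first half and the conjugate of s that maps the
   first half to the second. *)
pose J (c : {perm T} * 4.-tuple T) : (4 + 4).-tuple T := cat_tuple c.2 (map_tuple c.1 c.2).
have dsub : (4 + 4).-dtuple([set: T]) \subset J @: setX (s ^: 'Alt_T) setT.
  apply/subsetP => t td; have [g gA ->] := atransP2 trA t0d td.
  apply/imsetP; exists (s ^ g, map_tuple g u).
    by apply/setXP; split; [exact: memJ_class | rewrite inE].
  apply/val_inj; rewrite /= map_cat; congr cat.
  by rewrite -!map_comp; apply: eq_map => x /=; rewrite permJ.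
have := leq_trans (subset_leq_card dsub) (leq_imset_card _ _).
rewrite cardsX cardsT card_tuple => h.
have := leq_trans h (leq_mul hs (leqnn _)); rewrite -expnD => {}h.
have E : #|(4 + 4).-dtuple([set: T])| = #|T| ^_ 8.
  rewrite -(card_uniq_tuples 8 T); apply: eq_card => t; rewrite !inE andbC; congr andb.
  by apply/subsetP/allP => // _ x _; rewrite inE.
by have := ffact8_gt hT; rewrite -E ltnNge h.
Qed.

(* Conjugating q by the 3-cycles (a c d), with c and d outside U and moved q,
   gives conjugates of q that are distinguished by the points they move. *)
Lemma card_class_moved q U (A : {set {perm T}}) :
    (forall s, s \in A -> moved s \subset U) -> #|moved q| <= 9 ->
    ~~ (moved q \subset U) ->
  #|T| <= #|q ^: 'C_('Alt_T)(A)| + #|U| + 10.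
Proof.
move=> AU q9 /subsetPn[a aq aU]; set C := 'C_ _ (_).
pose W := ~: (U :|: moved q).
have cW : #|T| <= #|W| + #|U| + 9.
  rewrite -(cardsC (U :|: moved q)) addnC -addnA leq_add2l.
  by apply: leq_trans (leq_card_setU _ _) _; rewrite leq_add2l.
have [W0|[d dW]] := set_0Vmem W; first by rewrite W0 cards0 in cW; lia.
have WP c : c \in W -> [/\ c \notin U, q c = c & c != a].
  rewrite !inE negb_or negbK => /andP[-> /eqP qc]; split => //.
  by apply/negP => /eqP ca; move: aq; rewrite inE -ca qc eqxx.
(* The 3-cycle sending [a] to [c], [c] to [d] and [d] to [a]. Setting [d] aside turns the 9 of [cW]
   into the 10 of the statement. *)
pose g c := tperm a d * tperm d c.
have [dU qd da] := WP _ dW.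
have gP c : c \in W :\ d -> [/\ g c a = c, g c \in C & 
    forall b, b != a -> b != c -> b != d -> g c b = b].
  move=> /setD1P[cd cW']; have [cU qc ca] := WP _ cW'; split.
  - by rewrite permM tpermL tpermL.
  - rewrite inE Alt_even odd_permM !odd_tperm (eq_sym a d) (eq_sym d c) da cd /=.
    apply/centP => s sA; apply: (@perm_onC _ [set a; d; c] U).
    + apply/subsetP => b; rewrite !inE; apply: contraNT; rewrite !negb_or.
      move=> /andP[/andP[ba bd] bc].
      by rewrite permM !tpermD // eq_sym.
    + by rewrite perm_on_moved AU.
    + rewrite disjoint_subset; apply/subsetP => b; rewrite !inE.
      by case/orP => [/orP[]|] /eqP ->.
  - by move=> b ba bc bd; rewrite permM !tpermD // eq_sym.
have : #|W :\ d| <= #|q ^: C|.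
  rewrite -(@card_in_imset _ _ (fun c => q ^ g c)); last first.
    (* [q ^ g c] moves [c], the image of [a], whereas [q ^ g c'] fixes [c] because both [q] and
       [g c'] do. *)
    move=> c c' cW' c'W' E; apply/eqP/negPn/negP => cc'.
    have [gca _ gcb] := gP _ cW'; have [gca' _ gcb'] := gP _ c'W'.
    have : (q ^ g c) (g c a) != g c a.
      by rewrite permJ (inj_eq perm_inj); move: aq; rewrite inE.
    rewrite gca E /=.
    move: cW'; rewrite inE => /andP[]; rewrite inE => cd /WP[_ qc ca].
    have -> : (q ^ g c') c = (q ^ g c') (g c' c) by rewrite gcb'.
    by rewrite permJ qc gcb' // eqxx.
  apply/subset_leq_card/subsetP => _ /imsetP[c /gP[_ gC _] ->].
  exact: imset_f.
by move: cW; rewrite (cardsD1 d W) dW; lia.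
Qed.

(* The bound #|T| ^ 3 is the trivial one for 3-cycles. Class sizes are preserved
   by isomorphisms, so no knowledge of Aut 'Alt_T is needed. *)
Definition small_class : {set {perm T}} :=
  [set s in 'Alt_T | s != 1 & (#|s ^: 'Alt_T| <= #|T| ^ 3)%N].

(** A 3-cycle is even, and its conjugates are determined by the images of its three points. *)
Lemma small_class_exists : 3 <= #|T| -> exists s, s \in small_class.
Proof.
move=> hT; have [f] : exists f : 'I_3 -> T, injective f.
  exists (fun i => enum_val (widen_ord hT i)) => i j /enum_val_inj /(congr1 val) /= E.
  exact: val_inj.
move=> fI; pose a := f ord0; pose b := f 1%R; pose c := f ord_max.
have ab : a != b by rewrite (inj_eq fI).
have bc : b != c by rewrite (inj_eq fI).
have ac : a != c by rewrite (inj_eq fI).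
pose h (t : T * T * T) := tperm t.1.1 t.1.2 * tperm t.1.2 t.2.
exists (h (a, b, c)); rewrite inE Alt_even odd_permM !odd_tperm ab bc /=.
apply/andP; split.
  apply/eqP => /(congr1 (fun s : {perm T} => s a)); rewrite permM perm1 !tpermL.
  by apply/eqP; rewrite eq_sym.
apply: (@leq_trans #|h @: setT|).
  apply/subset_leq_card/subsetP => _ /imsetP[g _ ->]; apply/imsetP.
  by exists (g a, g b, g c); rewrite ?inE // /h /= conjMg !tpermJ.
by apply: leq_trans (leq_imset_card _ _) _; rewrite cardsT !card_prod !expnS expn0 muln1 mulnA.
Qed.

Lemma card_bigcup_moved (A : {set {perm T}}) : 1000 <= #|T| -> A \subset small_class ->
  #|\bigcup_(s in A) moved s| <= 9 * #|A|.
Proof.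
move=> hT AO; rewrite mulnC -sum_nat_const.
elim/big_rec2: _ => [|s m U sA IH]; first by rewrite cards0.
apply: leq_trans (leq_card_setU _ _) (leq_add _ IH).
by have := subsetP AO _ sA; rewrite inE => /and3P[_ _ /card_moved_le->].
Qed.

Lemma small_orbit_moved q (A : {set {perm T}}) :
    1000 <= #|T| -> A \subset small_class -> q \in small_class ->
    #|q ^: 'C_('Alt_T)(A)| + 9 * #|A| + 10 < #|T| ->
  moved q \subset \bigcup_(s in A) moved s.
Proof.
move=> hT AO; rewrite inE => /and3P[_ _ hq]; apply: contraTT => qU; rewrite -leqNgt.
apply: leq_trans (card_class_moved (A := A) (U := \bigcup_(s in A) moved s) _ _ qU) _.
- by move=> s sA; rewrite (bigcup_sup s).
- exact: card_moved_le.
by rewrite leq_add2r leq_add2l card_bigcup_moved.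
Qed.

(** By [small_orbit_moved], such a [q] permutes the at most [9 * #|A|] points moved by [A] and fixes
    all others. *)
Lemma card_small_orbit_perm (A : {set {perm T}}) :
    1000 <= #|T| -> A \subset small_class ->
  #|[set q in small_class | #|q ^: 'C_('Alt_T)(A)| + 9 * #|A| + 10 < #|T|]|
    <= (9 * #|A|)`!.
Proof.
move=> hT AO.
apply: (@leq_trans #|perm_on (\bigcup_(s in A) moved s)|).
  apply/subset_leq_card/subsetP => q; rewrite inE => /andP[qO hq].
  rewrite -[_ \in _]/(perm_on _ q) perm_on_moved.
  exact: small_orbit_moved.
by rewrite card_perm leq_fact // card_bigcup_moved.
Qed.

Lemma small_orbit_set0 q : 1000 <= #|T| -> q \in small_class ->
  #|T| <= #|q ^: 'C_('Alt_T)(set0)| + 10.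
Proof.
move=> hT qO; rewrite leqNgt; apply/negP => hq.
have := @small_orbit_moved q set0 hT (sub0set _) qO; rewrite cards0 muln0 addn0 => /(_ hq).
rewrite big_set0 subset0 => /eqP m0; move: qO; rewrite inE => /and3P[_ /eqP[]].
by apply/permP => a; move/setP/(_ a): m0; rewrite !inE perm1 => /negbFE/eqP.
Qed.
End SmallSupport.

(** * Alternating composition factors *)

(** For simple [A] this says that [A] is a composition factor of [G], in a form that descends to
    normal subgroups and quotients without handling series. *)
Definition subnormal_factor (aT gT : finGroupType) (A : {set aT}) (G : {set gT}) :=
  exists2 H : {group gT}, H <|<| G & A \homg H.

Section SubnormalFactor.
Variables (aT : finGroupType) (A : {group aT}).
Hypothesis simA : simple A.

Lemma subnormal_factor_isog (gT rT : finGroupType) (G : {group gT}) (H : {group rT}) :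
  G \isog H -> subnormal_factor A G -> subnormal_factor A H.
Proof.
case/isogP => f injf <- [K KG AK]; exists (f @* K)%G; first exact: morphim_subnormal.
apply: homg_trans AK (isog_hom _).
by apply: sub_isog injf; apply: subnormal_sub.
Qed.

(** The image of [H :&: N] in [A] is normal. If it is all of [A], then [N] has the factor; if it is
    trivial, the map factors through [H / N]. *)
Lemma subnormal_factor_split (gT : finGroupType) (G N : {group gT}) :
  N <| G -> subnormal_factor A G ->
  subnormal_factor A N \/ subnormal_factor A (G / N).
Proof.
move=> nNG [H HG /homgP[f fH]].
have sHG := subnormal_sub HG; have sNG := normal_sub nNG.
have nHN : H \subset 'N(N) := subset_trans sHG (normal_norm nNG).
have nfN : f @* (H :&: N) <| A by rewrite -fH morphim_normal // (normalGI sHG nNG).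
have [_ /(_ _ nfN) [f1|fA]] := simpleP _ simA; last first.
  left; exists (H :&: N)%G; first exact: setI_subnormal sNG HG.
  by have := morphim_homg f (subsetIl H N); rewrite fA.
right; exists (H / N)%G; first exact: quotient_subnormal.
have sK : N :&: H \subset 'ker f.
  have {}f1 : f @* (H :&: N) = 1 := f1.
  by rewrite setIC ker_trivg_morphim subsetIl f1 subxx.
apply: homg_trans (isog_hom (second_isog nHN)).
have -> : A \homg H / (N :&: H) = (f @* H \homg H / (N :&: H)) by rewrite fH.
apply: homg_trans (isog_hom _) (homg_quotientS _ (ker_norm f) sK).
  by rewrite isog_sym first_isog.
by rewrite normsI ?normG.
Qed.

Lemma subnormal_factor1 (gT : finGroupType) : ~ subnormal_factor A [1 gT].
Proof.
case=> H /subnormal_sub/trivgP -> /leq_homg; rewrite cards1 leqNgt cardG_gt1.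
by case/simpleP: simA => ->.
Qed.

Lemma subnormal_factor_simple (gT : finGroupType) (S : {group gT}) :
  simple S -> subnormal_factor A S -> S \isog A.
Proof.
move=> simS [H HS AH]; have [SH|[K [HK KS pKS]]] := subnormalEr HS.
  rewrite SH in AH; have /homgP[f fS] := AH.
  rewrite -fS; have [_ /(_ _ (ker_normal f)) [k1|kS]] := simpleP _ simS.
    by apply: sub_isog; rewrite ?k1.
  have : S \subset 'ker f by rewrite kS.
  rewrite ker_trivg_morphim fS => /andP[_ /trivgP A1].
  by case/simpleP: simA => /eqP[].
have [_ /(_ _ KS) [K1|KS']] := simpleP _ simS; last by rewrite KS' properxx in pKS.
by case: (@subnormal_factor1 gT); exists H; rewrite -?K1.
Qed.

(** One direct factor is split off at a time. A group found in the cofactor [Y] is normal in [G]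
    because the split factor centralises [Y]. *)
Lemma subnormal_factor_bigdprod (gT : finGroupType) (I : finType) (P : pred I)
    (F : I -> {set gT}) (G : {group gT}) :
  \big[dprod/1]_(i | P i) F i = G -> subnormal_factor A G ->
  exists2 i, P i & exists S : {group gT},
    [/\ S = F i :> {set gT}, S <| G & subnormal_factor A S].
Proof.
elim/big_rec: _ G => [|i y Pi IH] G EG AG; first by case: (@subnormal_factor1 gT); rewrite EG.
have [[S Y Fi Ey] EG' cSY _] := dprodP EG; have [nSG nYG] := dprod_normal2 EG.
rewrite Ey in nYG; case: (subnormal_factor_split nYG AG) => [AY|AGY]; last first.
  exists i => //; exists S; split=> //; first by rewrite -Fi.
  apply: subnormal_factor_isog AGY; rewrite isog_sym -Fi -Ey.
  exact: sdprod_isog (dprodWsdC EG).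
have [j Pj [S' [S'F S'Y AS']]] := IH _ Ey AY.
exists j => //; exists S'; split=> //.
have [sS'Y nS'Y] := andP S'Y; rewrite /normal (subset_trans sS'Y (normal_sub nYG)) /=.
rewrite -EG' Fi Ey mul_subG // (subset_trans _ (cent_sub _)) //.
by rewrite -Fi centsC (subset_trans sS'Y) // -Ey.
Qed.

(* In a smallest quotient with the factor A, a minimal normal subgroup N is a
   direct product of copies of A. *)
Lemma simple_defect2_quotient (gT : finGroupType) : subnormal_factor A [set: gT] ->
  exists (rT : finGroupType) (f : gT -> rT) (S N : {group rT}),
    [/\ {morph f : x y / x * y} /\ (forall q, exists x, f x = q),
      S <| N, N <| [set: rT], simple S & S \isog A].
Proof.
have [m] := ubnP #|gT|; elim: m gT => // m IHm gT; rewrite ltnS => gTm AG.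
have G1 : [set: gT]%G != 1 :> {set gT}.
  by apply/eqP => G1; case: (@subnormal_factor1 gT); rewrite -G1.
have [N minN _] := minnormal_exists G1 (normG _).
have /mingroupP[/andP[N1 nN] _] := minN.
have nNG : N <| [set: gT] by rewrite /normal subsetT.
case: (subnormal_factor_split nNG AG) => [AN|AGN].
  (* [N] is a direct product of images of the simple group [H] under automorphisms; one of them has
     the factor [A], hence is isomorphic to it. *)
  have [H [sHN simH [I IA EN]]] := charsimple_dprod (minnormal_charsimple minN).
  have [a aI [S [SE SN AS]]] := subnormal_factor_bigdprod EN AN.
  have aA := subsetP IA _ aI.
  have isoHS : H \isog S.
    have -> : S = (autm aA @* H)%G by apply: val_inj; rewrite /= SE morphimEsub.
    exact: sub_isog sHN (injm_autm aA).
  have simS : simple S by rewrite -(isog_simple isoHS).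
  exists gT, id, S, N; split => //; last exact: subnormal_factor_simple.
  by split=> // q; exists q.
have NT x : x \in 'N(N) by rewrite (subsetP (normal_norm nNG)) ?inE.
(* Otherwise the smaller group [[set: gT] / N] still has the factor, and its quotients are quotients
   of [gT]. *)
have [||rT [f [S [M [[fM fS] SM MT simS SA]]]]] := IHm (coset_of N).
- by rewrite -cardsT -quotientT (leq_trans _ gTm) // -cardsT ltn_quotient ?subsetT.
- by rewrite -quotientT.
exists rT, (f \o coset N), S, M; split => //; split=> [x y|q] /=.
  by rewrite -fM morphM.
by have [u <-] := fS q; have [x _ ->] := cosetP u; exists x.
Qed.
End SubnormalFactor.

Lemma alt_factor_subnormal (gT : finGroupType) k :
  alt_composition_factor gT k -> subnormal_factor 'Alt_('I_k) [set: gT].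
Proof.
case=> s [/compsP[_ sP] [i si]].
set G := [set: gT]%G in sP si *; set H := nth _ _ i; set K := nth _ _ _ => HK.
have maxK : maxnormal K H H by exact: pathP sP i si.
have HG : H <|<| G.
  rewrite /H {HK maxK H K}; elim: i si => [|i IHi] si /=; first exact: subnormal_refl.
  apply: subnormal_trans (IHi (ltnW si)); apply: normal_subnormal.
  exact: maxnormal_normal (pathP G sP i (ltnW si)).
exists H => //; have /andP[sKH nKH] := maxnormal_normal maxK.
rewrite isog_sym in HK.
exact: homg_trans (isog_hom HK) (quotient_homg nKH).
Qed.

(** * Centraliser orbits on the conjugates of a simple subnormal subgroup *)

Section ClosureInQuotient.
Variable T : finType.
Hypothesis hT : 1000 <= #|T|.

Lemma card_class_injm (aT rT : finGroupType) (D : {group aT}) (h : {morphism D >-> rT})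
    (q : aT) (A : {set aT}) :
  'injm h -> q \in D -> A \subset D -> #|h q ^: (h @* A)| = #|q ^: A|.
Proof.
move=> injh qD AD; rewrite morphimEsub //.
have -> : h q ^: (h @: A) = h @: (q ^: A).
  rewrite /class -!imset_comp; apply: eq_in_imset => x /(subsetP AD) xD /=.
  by rewrite morphJ.
rewrite card_in_imset // => x y /(subsetP (class_subG qD AD)) xD.
by move=> /(subsetP (class_subG qD AD)) yD; apply: (injmP injh).
Qed.

Lemma cent_set0 (gT : finGroupType) : 'C(set0) = [set: gT].
Proof. by rewrite /centraliser big_set0. Qed.

Section Transport.
Variables (gT : finGroupType) (S : {group gT}).
Hypothesis isoS : S \isog 'Alt_T.

Definition small_elements : {set gT} :=
  [set s in S | s != 1 & (#|s ^: S| <= #|T| ^ 3)%N].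

Lemma small_elements_exists : exists s, s \in small_elements.
Proof.
have [s] : exists s, s \in small_class T by apply: small_class_exists; apply: leq_trans hT.
case/isogP: isoS => h injh hS; rewrite inE -hS => /and3P[/morphimP[x _ xS ->] x1].
rewrite card_class_injm // => hx; exists x; rewrite inE xS hx andbT.
by apply: contra x1 => /eqP ->; rewrite morph1.
Qed.

Lemma small_elements_morph (h : {morphism S >-> {perm T}}) s :
  'injm h -> h @* S = 'Alt_T -> s \in small_elements -> h s \in small_class T.
Proof.
move=> injh hS; rewrite inE => /and3P[sS s1 hs].
rewrite inE -hS mem_morphim // card_class_injm // hs andbT.
by rewrite morph_injm_eq1.
Qed.

Lemma card_small_orbits_isog (A : {set gT}) : A \subset small_elements ->
  #|[set q in small_elements | #|q ^: 'C_S(A)| + 9 * #|A| + 10 < #|T|]| <= (9 * #|A|)`!.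
Proof.
case/isogP: isoS => h injh hS AO.
have sOS : small_elements \subset S by apply/subsetP => s; rewrite inE => /andP[].
have AS := subset_trans AO sOS.
have cA : #|h @* A| = #|A| by rewrite card_injm.
rewrite -cA -(@card_in_imset _ _ h); last first.
  by move=> x y; rewrite !inE => /andP[/andP[xS _] _] /andP[/andP[yS _] _]; apply: (injmP injh).
have hAO : h @* A \subset small_class T.
  by apply/subsetP => _ /morphimP[s _ /(subsetP AO) sO ->]; apply: small_elements_morph.
apply: leq_trans (card_small_orbit_perm hT hAO).
apply/subset_leq_card/subsetP => _ /imsetP[q + ->]; rewrite inE => /andP[qO hq].
rewrite inE small_elements_morph //= cA -hS -injm_subcent // card_class_injm ?subsetIl //.
  by rewrite -cA.
exact: (subsetP sOS _ qO).
Qed.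

Lemma card_class_small_elements q : q \in small_elements -> #|T| <= #|q ^: S| + 10.
Proof.
case/isogP: isoS => h injh hS qO; have := small_elements_morph injh hS qO.
move/(small_orbit_set0 hT); rewrite -[set0](morphim0 h) -hS -injm_subcent ?sub0set //.
move: qO; rewrite inE => /and3P[qS _ _].
by rewrite card_class_injm ?subsetIl // cent_set0 setIT.
Qed.
End Transport.

Section Quotient.
Variables (gT : finGroupType) (S N : {group gT}).
Hypotheses (SN : S <| N) (NT : N <| [set: gT]) (simS : simple S).
Hypothesis isoS : S \isog 'Alt_T.

Lemma conj_normal g : (S :^ g)%G <| N.
Proof.
have nNg : g \in 'N(N) by rewrite (subsetP (normal_norm NT)) ?inE.
by rewrite -(normP nNg) normalJ.
Qed.

Lemma conj_simple g : simple (S :^ g)%G.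
Proof. by rewrite -(isog_simple (conj_isog S g)). Qed.

(** Both conjugates are normal in [N], so their intersection is normal in each, and each is
    simple. *)
Lemma conj_TI g h : (S :^ g)%G = (S :^ h)%G \/ (S :^ g)%G :&: (S :^ h)%G = 1.
Proof.
have nI g1 g2 : ((S :^ g1) :&: (S :^ g2))%G <| (S :^ g1)%G.
  have [sg ng] := andP (conj_normal g1); have [_ nh] := andP (conj_normal g2).
  by rewrite /normal subsetIl normsI ?normG // (subset_trans sg).
have [_ /(_ _ (nI g h))[|E1]] := simpleP _ (conj_simple g); first by right.
have [_ /(_ _ (nI h g))[E2|E2]] := simpleP _ (conj_simple h).
  by right; rewrite setIC.
left; apply/group_inj; rewrite -E1 -E2; exact: setIC.
Qed.

Lemma conj_eq g h x : x != 1 -> x \in S :^ g -> x \in S :^ h -> (S :^ g)%G = (S :^ h)%G.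
Proof.
move=> x1 xg xh; case: (conj_TI g h) => // I1; move: x1.
by rewrite -in_set1 -[[set 1]]/[1 gT] -I1 inE xg xh.
Qed.

(** The commutator of two normal subgroups of [N] lies in their intersection. *)
Lemma conj_cent g h : (S :^ g)%G <> (S :^ h)%G -> S :^ g \subset 'C(S :^ h).
Proof.
case: (conj_TI g h) => // I1 _.
have [sg ng] := andP (conj_normal g); have [sh nh] := andP (conj_normal h).
apply/commG1P/trivgP; rewrite -I1 commg_subI // subsetI ?subxx.
  exact: subset_trans sg nh.
exact: subset_trans sh ng.
Qed.

Variables (p0 : gT) (L : nat).
Hypothesis p0_small : p0 \in small_elements S.

(* An element of p0 ^: [set: gT] lies in exactly one conjugate of S, and its class
   there has the size of the class of p0 in S. *)
Lemma class_conj g q : q \in p0 ^: [set: gT] -> q \in S :^ g -> q \in small_elements (S :^ g).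
Proof.
move: p0_small; rewrite inE => /and3P[p0S p01 hp0] /imsetP[h _ ->{q}] p0g.
have p0h1 : p0 ^ h != 1 by rewrite conjg_eq1.
have -> : (S :^ g)%G = (S :^ h)%G.
  by apply: (conj_eq p0h1 p0g); rewrite memJ_conjg.
rewrite inE memJ_conjg p0S p0h1 /=; apply: leq_trans hp0.
rewrite (_ : _ ^: _ = (p0 ^: S) :^ h) ?cardJg //.
apply/setP => y; apply/imsetP/imsetP => [[c cS ->]|[z /imsetP[c cS ->] ->]].
  by exists (p0 ^ (c ^ h^-1)); [rewrite imset_f // -mem_conjg | rewrite [RHS]conjJg conjgKV].
by exists (c ^ h); [rewrite memJ_conjg | apply: conjJg].
Qed.

Lemma isog_conj g : (S :^ g)%G \isog 'Alt_T.
Proof. by apply: isog_trans isoS; rewrite isog_sym conj_isog. Qed.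

(** Elements of [V] outside [S :^ g] lie in other conjugates of [S], which commute with [S :^ g];
    only [V :&: S :^ g] restricts its elements. *)
Lemma card_local_class (V : {set gT}) g q :
    V \subset p0 ^: [set: gT] -> q \in S :^ g ->
  #|q ^: 'C_(S :^ g)(V :&: S :^ g)| <= #|q ^: 'C(V)|.
Proof.
move=> VO qg; apply/subset_leq_card/imsetS.
apply/subsetP => c /setIP[cg /centP cC]; apply/centP => v vV.
have /imsetP[h _ Ev] := subsetP VO _ vV.
have vh : v \in S :^ h by rewrite Ev memJ_conjg; move: p0_small; rewrite inE => /and3P[].
case: (eqVneq (S :^ g)%G (S :^ h)%G) => [E|/eqP ne].
  by apply: cC; rewrite inE vV; move/(congr1 val): E => /= ->.
by apply: (centP (subsetP (conj_cent ne) _ cg)).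
Qed.

Lemma card_small_orbits_quotient (V : {set gT}) :
    V \subset p0 ^: [set: gT] -> #|V| <= L ->
  #|[set q in p0 ^: [set: gT] | #|q ^: 'C(V)| + 9 * L + 10 < #|T|]| <= L * (9 * L)`!.
Proof.
move=> VO VL; set Bad := [set q in _ | _].
pose F v := [set q in Bad | [exists g, (v \in S :^ g) && (q \in S :^ g)]].
have p0S : p0 \in S by move: p0_small; rewrite inE => /and3P[].
have p0n1 : p0 != 1 by move: p0_small; rewrite inE => /and3P[].
have BadF : Bad \subset \bigcup_(v in V) F v.
  apply/subsetP => q qBad; move: (qBad); rewrite inE => /andP[qO hq].
  have /imsetP[g _ Eq] := qO; have qg : q \in S :^ g by rewrite Eq memJ_conjg.
  (* If the conjugate containing [q] misses [V], all of it centralises [V], and the class of [q] in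
     it is already too large for [Bad]. *)
  have [V0|[v]] := set_0Vmem (V :&: S :^ g).
    have := card_local_class VO qg; rewrite V0 cent_set0 setIT => hl.
    have := card_class_small_elements (isog_conj g) (class_conj qO qg).
    by move: hq hl => /=; lia.
  case/setIP => vV vg; apply/bigcupP; exists v => //; rewrite inE qBad.
  by apply/existsP; exists g; rewrite vg.
apply: leq_trans (subset_leq_card BadF) _.
apply: (@leq_trans (\sum_(v in V) (9 * L)`!)); last first.
  by rewrite sum_nat_const leq_mul2r VL orbT.
elim/big_rec2: _ => [|v m U vV IH]; first by rewrite cards0.
apply: leq_trans (leq_card_setU _ _) (leq_add _ IH).
have /imsetP[h _ Ev] := subsetP VO _ vV.
have v1 : v != 1 by rewrite Ev conjg_eq1.
have vh : v \in S :^ h by rewrite Ev memJ_conjg.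
have Vh : V :&: S :^ h \subset small_elements (S :^ h).
  by apply/subsetP => u /setIP[/(subsetP VO) uO uh]; apply: class_conj.
have cV : #|V :&: S :^ h| <= L by apply: leq_trans (subset_leq_card (subsetIl _ _)) VL.
apply: leq_trans (leq_trans (card_small_orbits_isog (isog_conj h) Vh) _); last first.
  by apply: leq_fact; rewrite leq_mul2l.
apply/subset_leq_card/subsetP => q; rewrite inE => /andP[qBad /existsP[g /andP[vg qg]]].
(* Only one conjugate contains [v], so the bound for a single alternating group covers [F v]. *)
have Egh := congr1 val (conj_eq v1 vg vh); rewrite /= in Egh; rewrite Egh in qg.
move: qBad; rewrite inE => /andP[qO hq]; rewrite inE (class_conj qO qg) /=.
apply: leq_ltn_trans hq; rewrite leq_add2r leq_add ?leq_mul2l ?cV ?orbT //.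
exact: card_local_class.
Qed.
End Quotient.
End ClosureInQuotient.

Lemma card_word_eq1_defect2 (gT : finGroupType) (S N : {group gT}) (k n : nat) (w : word n) :
    S <| N -> N <| [set: gT] -> simple S -> S \isog 'Alt_('I_k) ->
    1000 + 9 * size w + 12 <= k -> reduced_word w -> w <> [::] ->
  (k - (9 * size w + 10)) * #|[set x : {ffun 'I_n -> gT} | word_val w x == 1]|
    <= size w * (size w * (9 * size w)`!) * #|{ffun 'I_n -> gT}|.
Proof.
move=> SN NT simS isoS hk red w0; set L := size w in hk *.
have hT : 1000 <= #|'I_k| by rewrite card_ord; lia.
have [p0 p0S] := small_elements_exists hT isoS.
have hO := card_small_orbits_quotient hT SN NT simS isoS p0S; rewrite card_ord in hO.
apply: (@card_word_eq1 _ _ (p0 ^: [set: gT]) L _ _ p0) => //.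
- by move=> a c /imsetP[g _ ->]; rewrite -conjgM imset_f ?inE.
- by lia.
- move=> V VO VL; have VO' : [set:: V] \subset p0 ^: [set: gT].
    by apply/subsetP => v; rewrite inE; apply: VO.
  have VL' : #|[set:: V]| <= L by rewrite cardsE (leq_trans (card_size V)).
  apply: leq_trans (hO L _ VO' VL'); apply/subset_leq_card/subsetP => q.
  by rewrite !inE => /andP[-> /=]; lia.
- exact: class_refl.
(* For L = 0 the bound on exceptional points is 0, so [p0] itself has a large class. *)
have := hO 0 set0 (sub0set _); rewrite cards0 leqnn mul0n leqn0 cards_eq0 => /(_ isT)/eqP.
move/setP/(_ p0); rewrite !inE class_refl /= => /negbT; rewrite -leqNgt => h.
rewrite (_ : [set:: [::]] = set0); last by apply/setP => x; rewrite !inE.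
by move: h; lia.
Qed.

Lemma alt_factor_word_bound (gT : finGroupType) (k n : nat) (w : word n) :
    alt_composition_factor gT k ->
    1000 + 9 * size w + 12 <= k -> reduced_word w -> w <> [::] ->
  exists (rT : finGroupType) (f : gT -> rT),
    [/\ {morph f : x y / x * y}, (forall q, exists x, f x = q) &
      (k - (9 * size w + 10)) * #|[set x : {ffun 'I_n -> rT} | word_val w x == 1]|
        <= size w * (size w * (9 * size w)`!) * #|{ffun 'I_n -> rT}|].
Proof.
move=> /alt_factor_subnormal Ak hk red w0.
have simA : simple 'Alt_('I_k) by apply: simple_Alt5; rewrite card_ord; lia.
have [rT [f [S [N [[fM fS] SN NT simS isoS]]]]] := simple_defect2_quotient simA Ak.
by exists rT, f; split => //; apply: card_word_eq1_defect2 SN NT simS isoS hk red w0.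
Qed.

(** * Haar measure *)

From mathcomp Require Import all_classical all_reals all_analysis.

Import Order.TTheory GRing.Theory Num.Theory.

Local Open Scope classical_set_scope.
Local Open Scope ring_scope.

Section HaarFibers.
Variables (G : ptopologicalType) (mul : G -> G -> G) (inv : G -> G) (one : G).
Hypothesis profG : is_profinite_group mul inv one.
Variables (rT : finGroupType) (f : G -> rT).
Hypothesis quof : continuous_finite_quotient mul f.
Variables (n : nat) (R : realType) (mu : probability (borel_tuples G n) R).
Hypothesis haar : haar_probability mul mu.

Lemma quotient_morph_one : f one = 1%g.
Proof.
have [_ [mul1 _] _ _ _] := profG; have [fM _ _] := quof.
by apply: (@mulIg _ (f one)); rewrite -fM mul1 mul1g.
Qed.

Lemma quotient_morph_inv x : f (inv x) = ((f x)^-1)%g.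
Proof.
have [_ [_ mulV] _ _ _] := profG; have [fM _ _] := quof.
by apply: (@mulIg _ (f x)); rewrite -fM mulV quotient_morph_one mulVg.
Qed.

Definition fiber (y : {ffun 'I_n -> rT}) : set (borel_tuples G n) :=
  [set x | forall i, f (x i) = y i].

Lemma open_fiber y : @open {ptws 'I_n -> G} (fiber y).
Proof.
have [_ _ of_] := quof.
rewrite openE => x xy.
apply: (@filter_forall {ptws 'I_n -> G} 'I_n (fun i z => f (z i) = y i) (nbhs x) _) => i.
have fo : nbhs (x i) (f @^-1` [set y i]) by apply: open_nbhs_nbhs; split; [exact: of_|exact: xy].
exact: (@proj_continuous _ (fun=> G) i x _ fo).
Qed.

Lemma measurable_fiber y : measurable (fiber y).
Proof. by apply: sub_sigma_algebra; apply: open_fiber. Qed.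

(** Left translation by a lift of [z * y^-1] pulls the fibre of [z] back to that of [y]. *)
Lemma fiber_translate y z : mu (fiber y) = mu (fiber z).
Proof.
have [fM fS _] := quof.
have /boolp.choice[g gE] : forall i, exists a, f a = (z i * (y i)^-1)%g by move=> i.
rewrite -(haar g (measurable_fiber z)); congr (mu _).
apply/seteqP; split=> x /= h i; rewrite /ltrans.
  by rewrite fM gE h mulgKV.
have := h i; rewrite /ltrans fM gE -mulgA -[in RHS](mulg1 (z i)) => /mulgI/mulg1_eq.
by rewrite invgK.
Qed.

Definition fibers (A : {set {ffun 'I_n -> rT}}) : set (borel_tuples G n) :=
  \bigcup_(z in [set` enum A]) fiber z.

Lemma measurable_fibers A : measurable (fibers A).
Proof. by apply: fin_bigcup_measurable => // z _; apply: measurable_fiber. Qed.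

Lemma mem_fibers A x : fibers A x <-> [ffun i => f (x i)] \in A.
Proof.
split=> [[z /=]|xA].
  rewrite mem_enum => zA zx; suff -> : [ffun i => f (x i)] = z by [].
  by apply/ffunP => i; rewrite ffunE zx.
by exists [ffun i => f (x i)] => [/=|i /=]; rewrite ?mem_enum ?ffunE.
Qed.

Lemma mu_fibers A y : mu (fibers A) = (#|A|%:R%:E * mu (fiber y))%E.
Proof.
rewrite measure_fin_bigcup //; last 2 first.
- apply/trivIsetP => z t _ _ zt; apply/seteqP; split=> x // -[xz xt].
  by case/eqP: zt; apply/ffunP => i; rewrite -xz -xt.
- by move=> z _; apply: measurable_fiber.
rewrite -fsbig_seq ?enum_uniq // big_enum /=.
rewrite (eq_bigr (fun=> mu (fiber y))); last by move=> z _; apply: fiber_translate.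
by rewrite sumr_const mule_natl.
Qed.

Lemma quotient_eval_word (w : word n) (x : 'I_n -> G) :
  f (eval_word mul inv one w x) = word_val w [ffun i => f (x i)].
Proof.
have [fM _ _] := quof; elim: w => [|[i b] w IHw] /=; first exact: quotient_morph_one.
rewrite fM IHw /word_val /= ffunE; case: b => //=.
by rewrite quotient_morph_inv.
Qed.

Lemma mu_fibers_le (A : {set {ffun 'I_n -> rT}}) (b d : nat) :
  (b * #|A| <= d * #|{ffun 'I_n -> rT}|)%N -> (b%:R%:E * mu (fibers A) <= d%:R%:E)%E.
Proof.
move=> hA; pose y : {ffun 'I_n -> rT} := [ffun=> 1%g].
(* The fibres share the total mass 1 equally, which turns the counting bound into one on
   measures. *)
have m1 : mu (fibers [set: {ffun 'I_n -> rT}]%SET) = 1%E.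
  rewrite -(probability_setT mu); congr (mu _).
  by apply/seteqP; split=> x _ //; apply/mem_fibers; rewrite inE.
have fin : mu (fiber y) \is a fin_num by apply: fin_num_measure; apply: measurable_fiber.
move: m1; rewrite !(mu_fibers _ y) cardsT; move: fin.
have c0 : (0 <= mu (fiber y))%E by apply: measure_ge0.
case: (mu (fiber y)) c0 => // c; rewrite lee_fin => c0 _ /eqP; rewrite eqe => /eqP c1.
have -> : d%:R = d%:R * (#|{ffun 'I_n -> rT}|%:R * c) :> R by rewrite c1 mulr1.
rewrite -!EFinM lee_fin !mulrA -!natrM.
by rewrite ler_wpM2r // ler_nat.
Qed.
End HaarFibers.

Lemma continuous_finite_quotient_comp (G : ptopologicalType) (mul : G -> G -> G)
    (gT rT : finGroupType) (f : G -> gT) (h : gT -> rT) :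
  continuous_finite_quotient mul f -> {morph h : x y / (x * y)%g} ->
  (forall q, exists x, h x = q) -> continuous_finite_quotient mul (h \o f).
Proof.
move=> [fM fS fo] hM hS; split=> [x y|q|q] /=; first by rewrite fM hM.
  by have [p <-] := hS q; have [x <-] := fS p; exists x.
rewrite (_ : _ @^-1` _ = \bigcup_(p in [set p | h p = q]) f @^-1` [set p]).
  by apply: bigcup_open => p _; apply: fo.
by apply/seteqP; split=> [x /= hx|x [p /= <- ->]] //; exists (f x).
Qed.

(** * The solutions of one word equation have measure zero *)

Section WordSolutions.
Variables (G : ptopologicalType) (mul : G -> G -> G) (inv : G -> G) (one : G).
Hypothesis profG : is_profinite_group mul inv one.
Hypothesis altG : unbounded_alt_factors mul.
Variables (n : nat) (R : realType) (mu : probability (borel_tuples G n) R).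
Hypothesis haar : haar_probability mul mu.
Variable w : word n.
Hypotheses (w_red : reduced_word w) (w_nil : w <> [::]).

Lemma word_solutions_cover (m : nat) : exists C : set (borel_tuples G n),
  [/\ measurable C, (forall x, eval_word mul inv one w x = one -> C x) &
      (m%:R%:E * mu C <= (size w * (size w * (9 * size w)`!))%:R%:E)%E].
Proof.
(* This degree makes [k - (9 * size w + 10)] at least [m], while the right-hand side of the bound
   does not depend on [k]. *)
have [k hk [gT [f [quof Ak]]]] := altG (m + 1000 + 9 * size w + 12)%N.
have [|rT [h [hM hS hB]]] := alt_factor_word_bound Ak _ w_red w_nil.
  by move: hk; lia.
have quoh := continuous_finite_quotient_comp quof hM hS.
exists (fibers (h \o f) [set x : {ffun 'I_n -> rT} | word_val w x == 1%g]%SET); split.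
- exact: (measurable_fibers quoh).
- move=> x wx; apply: (mem_fibers (h \o f) _ x).2; rewrite inE -(quotient_eval_word profG quoh) wx.
  by apply/eqP; exact: (quotient_morph_one profG quoh).
apply: (mu_fibers_le quoh haar); apply: leq_trans hB; rewrite leq_mul2r; apply/orP; right.
by move: hk; lia.
Qed.

Lemma word_solutions_negligible :
  mu.-negligible [set x : borel_tuples G n | eval_word mul inv one w x = one].
Proof.
have /boolp.choice[C CP] := word_solutions_cover.
have mC m : measurable (C m) by have [] := CP m.
have mI : measurable (\bigcap_m C m) by apply: bigcap_measurable.
exists (\bigcap_m C m); split=> //; last first.
  by move=> x wx m _; have [_ + _] := CP m; apply.
set d := (size w * (size w * (9 * size w)`!))%N in CP.
have hle m : (m%:R%:E * mu (\bigcap_m C m) <= d%:R%:E)%E.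
  have [_ _ h] := CP m; apply: le_trans h; apply: lee_wpmul2l.
    by rewrite lee_fin.
  by apply: le_measure; rewrite ?inE //; apply: bigcap_inf.
have fin : mu (\bigcap_m C m) \is a fin_num by apply: fin_num_measure.
have c0 : (0 <= mu (\bigcap_m C m))%E by apply: measure_ge0.
move: (mu _) fin c0 hle => [c| |] // _; rewrite lee_fin le_eqVlt => /orP[/eqP <- //|c0] hle.
(* A positive measure [c] would violate [hle] at an integer above d / c. *)
have := hle (Num.bound (d%:R / c)); rewrite -EFinM lee_fin leNgt.
by rewrite -ltr_pdivrMr // archi_boundP // divr_ge0 // ltW.
Qed.
End WordSolutions.

Theorem theorem7 (G : ptopologicalType) (mul : G -> G -> G) (inv : G -> G)
  (one : G) :
  is_profinite_group mul inv one ->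
  unbounded_alt_factors mul ->
  forall (n : nat), (1 <= n)%N ->
  forall (R : realType) (mu : probability (borel_tuples G n) R),
    haar_probability mul mu ->
    {ae mu, forall x : borel_tuples G n, freely_generates mul inv one x}.
Proof.
move=> profG altG n _ R mu haar.
(* Words are countable: [F] runs through their solution sets, with the empty set at indices that
   code no nonempty reduced word. *)
pose F (m : nat) : set (borel_tuples G n) :=
  if unpickle m is Some w then
    if reduced_word (w : word n) && (w != [::]) then
      [set x : borel_tuples G n | eval_word mul inv one w x = one]
    else set0
  else set0.
apply: (@negligibleS _ _ _ mu (\bigcup_m F m)).
  move=> x /= /existsNP[w /not_implyP[wr /not_implyP[w0 /contrapT wx]]].
  by exists (pickle w) => //; rewrite /F pickleK wr /=; case: eqP w0.
apply: negligible_bigcup => m; rewrite /F.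
case: unpickle => [w|]; last exact: negligible_set0.
case: ifP => [/andP[wr /eqP w0]|_]; last exact: negligible_set0.
exact: word_solutions_negligible.
Qed.
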